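(* Let $\mu$ be a Borel probability measure on $\mathbb{R}^n$ and $\Lambda\subset\mathbb{R}^n$. The following are equivalent: (i) $\{e_\lambda\}_{\lambda\in\Lambda}$ is orthogonal in $L^2(\mu)$; (ii) with $\mathcal{H}(\Lambda)$ the closed linear span of $\{e_\lambda\}_{\lambda\in\Lambda}$ in $L^2(\mu)$, there is a linear isometry $W_\Lambda:\mathcal{H}(\Lambda)\to L^2(G,\mu_{Bohr})$ with $W_\Lambda e_\lambda=\tilde e_\lambda$ for all $\lambda\in\Lambda$; (iii) the function $h_\Lambda(t):=\sum_{\lambda\in\Lambda}|\hat\mu(t-\lambda)|^2$ satisfies $h_\Lambda(t)\le 1$ for all $t\in\mathbb{R}^n$.
   Context: $e_\lambda(x)=e^{2\pi i\lambda\cdot x}$; $\hat\mu(t)=\int e^{2\pi it\cdot x}\,d\mu(x)$. The Bohr compactification $G$ is the set of all group homomorphisms $\chi:\mathbb{R}^n\to\mathbb{T}$ with pointwise multiplication and the topology of pointwise convergence (a compact abelian group, the dual of $\mathbb{R}^n$ with discrete topology); $\mu_{Bohr}$ is its normalized Haar measure, and $\tilde e_\lambda(\chi)=\chi(\lambda)$ for $\chi\in G$. *)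

(* Defs.v *)
(* mathcomp-analysis (measure/integration) + real_closed complex R[i]. *)
From HB Require Import structures.
From mathcomp Require Import all_boot all_order all_algebra.
From mathcomp Require Import all_classical all_reals all_analysis.
From mathcomp Require Import complex.

Set Implicit Arguments.
Unset Strict Implicit.
Unset Printing Implicit Defensive.

Import Order.TTheory GRing.Theory Num.Theory.
Import numFieldNormedType.Exports.
Local Open Scope classical_set_scope.
Local Open Scope ring_scope.
Local Open Scope complex_scope.

Section Defs.
Variables (R : realType) (n : nat).

(** R^n (row vectors) with its Borel sigma-algebra *)
Definition Rn := g_sigma_algebraType (@open 'rV[R]_n).

(** standard inner product on R^n *)
Definition dotp (u v : 'rV[R]_n) : R := \sum_(i < n) u ord0 i * v ord0 i.

(** e^{i theta} *)
Definition expi (theta : R) : R[i] := cos theta +i* sin theta.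

(** e_lambda(x) = e^{2 pi i lambda . x} *)
Definition ex (l : 'rV[R]_n) (x : 'rV[R]_n) : R[i] := expi (2 * pi * dotp l x).

(** |z|^2 as a real number *)
Definition csq (z : R[i]) : R := complex.Re z ^+ 2 + complex.Im z ^+ 2.

Section OnSpace.
Context d (T : measurableType d) (mu : {measure set T -> \bar R}).

(** integral of a complex-valued function (real and imaginary parts) *)
Definition cint (f : T -> R[i]) : R[i] :=
  Rintegral mu setT (fun x => complex.Re (f x)) +i* Rintegral mu setT (fun x => complex.Im (f x)).

(** L^2 inner product <f, g> = int f conj(g) dmu *)
Definition cinner (f g : T -> R[i]) : R[i] := cint (fun x => f x * (g x)^*).

Definition cmeasurable (f : T -> R[i]) : Prop :=
  measurable_fun setT (fun x => complex.Re (f x)) /\ measurable_fun setT (fun x => complex.Im (f x)).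

(** squared L^2 norm (in extended reals) *)
Definition L2norm2 (f : T -> R[i]) : \bar R := (\int[mu]_x (csq (f x))%:E)%E.

(** f is (a representative of an element) in L^2(mu) *)
Definition L2 (f : T -> R[i]) : Prop := cmeasurable f /\ (L2norm2 f < +oo)%E.

(** squared L^2 distance *)
Definition L2dist2 (f g : T -> R[i]) : \bar R := L2norm2 (fun x => f x - g x).

End OnSpace.

(** Fourier transform hat mu(t) = int e^{2 pi i t.x} dmu(x) *)
Definition fourier (mu : {measure set Rn -> \bar R}) (t : 'rV[R]_n) : R[i] :=
  cint mu (ex t).

(** finite linear combinations of the e_lambda, lambda in Lam *)
Definition exp_span (Lam : set 'rV[R]_n) (f : 'rV[R]_n -> R[i]) : Prop :=
  exists s : seq (R[i] * 'rV[R]_n),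
    (forall p, p \in s -> Lam p.2) /\
    f = (fun x => \sum_(p <- s) p.1 * ex p.2 x).

(** H(Lam): closed linear span of the e_lambda in L^2(mu) (all representatives) *)
Definition H_span (mu : {measure set Rn -> \bar R}) (Lam : set 'rV[R]_n)
    (f : Rn -> R[i]) : Prop :=
  L2 mu f /\
  forall eps : R, 0 < eps ->
    exists g, exp_span Lam g /\ (L2dist2 mu f g < eps%:E)%E.

(** The Bohr compactification G of R^n: all group homomorphisms R^n -> T *)
Record bohr := Bohr {
  bchar :> 'rV[R]_n -> R[i];
  bchar_mul : forall u v, bchar (u + v) = bchar u * bchar v;
  bchar_norm : forall u, `|bchar u| = 1 }.

Lemma bohr1_mul (u v : 'rV[R]_n) : (1 : R[i]) = 1 * 1.
Proof. by rewrite mulr1. Qed.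
Lemma bohr1_norm (u : 'rV[R]_n) : `|(1 : R[i])| = 1.
Proof. by rewrite normr1. Qed.
Definition bohr1 : bohr := @Bohr (fun _ => 1) bohr1_mul bohr1_norm.

HB.instance Definition _ := gen_eqMixin bohr.
HB.instance Definition _ := gen_choiceMixin bohr.
HB.instance Definition _ := isPointed.Build bohr bohr1.

Lemma bmul_mul (a b : bohr) u v :
  a (u + v) * b (u + v) = (a u * b u) * (a v * b v).
Proof. by rewrite !bchar_mul mulrACA. Qed.
Lemma bmul_norm (a b : bohr) u : `|a u * b u| = 1.
Proof. by rewrite normrM !bchar_norm mulr1. Qed.

(** group law of G (pointwise multiplication) *)
Definition bmul (a b : bohr) : bohr := @Bohr (fun u => a u * b u) (bmul_mul a b) (bmul_norm a b).

(** sigma-algebra on G generated by the evaluations chi |-> chi(lambda)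
    (real and imaginary parts), i.e. the Baire sigma-algebra of the
    pointwise-convergence topology *)
Definition bohr_gen : set (set bohr) :=
  [set A | exists (l : 'rV[R]_n) (B : set R), measurable B /\
     (A = [set chi : bohr | B (complex.Re (chi l))] \/ A = [set chi : bohr | B (complex.Im (chi l))])].

Definition BohrG := g_sigma_algebraType bohr_gen.

(** translation-invariant probability measure on G (normalized Haar measure) *)
Definition bohr_haar (nu : probability BohrG R) : Prop :=
  forall (a : BohrG) (A : set BohrG), measurable A -> nu (bmul a @` A) = nu A.

(** tilde e_lambda (chi) = chi(lambda) *)
Definition ex_bohr (l : 'rV[R]_n) (chi : BohrG) : R[i] := bchar chi l.

End Defs.

(* Main.v *)
(* Characters are orthonormal in L^2(G): for a in G, invariance gives
   int chi(u) = a(u) int chi(u), and for u <> 0 some a has a(u) <> 1.  So under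
   (i) the e_lambda and the ~e_lambda have the same Gram matrix, and
   e_lambda |-> ~e_lambda extends to the closed spans by completeness of L^2(G);
   conversely an isometry preserves the norms of a e_l + b e_l', hence inner
   products.  Since <e_t, e_lambda> = hat mu(t - lambda), (iii) is Bessel's
   inequality for e_t; at t in Lambda its term lambda = t already equals 1, so
   all other terms vanish. *)
Require Import Defs.
From HB Require Import structures.
From mathcomp Require Import all_boot all_order all_algebra.
From mathcomp Require Import all_classical all_reals all_analysis.
From mathcomp Require Import complex measurable_realfun.
From mathcomp Require Import ring lra.
Import Order.TTheory GRing.Theory Num.Theory.
Import numFieldNormedType.Exports.
Local Open Scope classical_set_scope.
Local Open Scope ring_scope.

Set Implicit Arguments.
Unset Strict Implicit.
Unset Printing Implicit Defensive.

(** Everything is stated for functions, not for classes: equality in L2 means distance zero, and the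
    isometry of (ii) has to be a function of representatives. It is therefore built as a relation,
    [paired f F], in which the same finite combinations approximate [f] on one side and [F] on the
    other. The relation preserves norms, is linear, single-valued up to distance zero and total on
    [H_span]; only then is an image chosen for each [f]. Norms occur squared and in the extended
    reals. The substitute for the triangle inequality is |z + w|^2 <= (1 + c)|z|^2 + (1 + 1/c)|w|^2
    with c > 0 free: c = 1 serves for rough estimates, and letting c tend to 0 recovers the sharp
    constant where norms must be equal. Both families of exponentials have modulus one over a
    probability measure. Their products are thus bounded and integrable, so expansions of inner
    products are proved once, for an arbitrary unimodular family, and used on both sides. *)

Section ComplexAlgebra.
Context {R : realType}.
Implicit Types z w : R[i].

Lemma Re_add z w : complex.Re (z + w) = complex.Re z + complex.Re w.
Proof. by case: z; case: w. Qed.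

Lemma Im_add z w : complex.Im (z + w) = complex.Im z + complex.Im w.
Proof. by case: z; case: w. Qed.

Lemma Re_opp z : complex.Re (- z) = - complex.Re z.
Proof. by case: z. Qed.

Lemma Im_opp z : complex.Im (- z) = - complex.Im z.
Proof. by case: z. Qed.

Lemma Re_mul z w : complex.Re (z * w) =
  complex.Re z * complex.Re w - complex.Im z * complex.Im w.
Proof. by case: z; case: w. Qed.

Lemma Im_mul z w : complex.Im (z * w) =
  complex.Re z * complex.Im w + complex.Im z * complex.Re w.
Proof. by case: z; case: w. Qed.

Lemma Re_conj z : complex.Re z^* = complex.Re z.
Proof. by case: z. Qed.

Lemma Im_conj z : complex.Im z^* = - complex.Im z.
Proof. by case: z. Qed.

Lemma complex_ext z w :
  complex.Re z = complex.Re w -> complex.Im z = complex.Im w -> z = w.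
Proof. by case: z; case: w => ? ? ? ? /= -> ->. Qed.

Definition complexRI :=
  (Re_add, Im_add, Re_opp, Im_opp, Re_mul, Im_mul, Re_conj, Im_conj).

Lemma csq_ge0 z : 0 <= csq z.
Proof. by rewrite /csq addr_ge0 // sqr_ge0. Qed.

Lemma csq_eq0 z : csq z = 0 -> z = 0.
Proof.
move=> /eqP; rewrite /csq paddr_eq0 ?sqr_ge0// !sqrf_eq0 => /andP[/eqP Re0 /eqP Im0].
exact: complex_ext.
Qed.

Lemma csqM z w : csq (z * w) = csq z * csq w.
Proof. rewrite /csq !complexRI; ring. Qed.

Lemma csqN z : csq (- z) = csq z.
Proof. rewrite /csq !complexRI; ring. Qed.

Lemma csq_mul_conj z : csq z = complex.Re (z * z^*).
Proof. rewrite /csq !complexRI; ring. Qed.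

Lemma mul_conj_csq z : csq z = 1 -> z * z^* = 1.
Proof.
rewrite /csq => z1; apply: complex_ext; rewrite !complexRI /=; first by rewrite -z1; ring.
ring.
Qed.

Lemma csq_norm z : `|z| = 1 -> csq z = 1.
Proof.
move=> z1; have := add_Re2_Im2 z.
by rewrite z1 expr1n => /(congr1 (@complex.Re R)).
Qed.

(** Young's inequality with a weight: in each coordinate the difference of the two sides is the
    square c(x - y/c)^2. *)
Lemma csqD_le (c : R) z w : 0 < c ->
  csq (z + w) <= (1 + c) * csq z + (1 + c^-1) * csq w.
Proof.
move=> c0.
have key (x y : R) : (x + y) ^+ 2 <= (1 + c) * x ^+ 2 + (1 + c^-1) * y ^+ 2.
  rewrite -subr_ge0.
  have -> : (1 + c) * x ^+ 2 + (1 + c^-1) * y ^+ 2 - (x + y) ^+ 2 =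
    c * (x - c^-1 * y) ^+ 2 by field; rewrite gt_eqF.
  by rewrite mulr_ge0 ?sqr_ge0// ltW.
have := lerD (key (complex.Re z) (complex.Re w)) (key (complex.Im z) (complex.Im w)).
rewrite /csq !complexRI => /le_trans; apply.
rewrite le_eqVlt; apply/orP; left; apply/eqP; ring.
Qed.

End ComplexAlgebra.

(** * Measurability and squared norms of complex functions *)

Section L2Theory.
Context {R : realType} d (T : measurableType d).
Implicit Types f g : T -> R[i].

Lemma cmeasurable_cst (a : R[i]) : cmeasurable (fun _ : T => a).
Proof. by split; exact: measurable_cst. Qed.

Lemma cmeasurableD f g : cmeasurable f -> cmeasurable g ->
  cmeasurable (fun x => f x + g x).
Proof.
move=> [fr fi] [gr gi]; split.
- by under eq_fun do rewrite Re_add; exact: measurable_funD.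
- by under eq_fun do rewrite Im_add; exact: measurable_funD.
Qed.

Lemma cmeasurableM f g : cmeasurable f -> cmeasurable g ->
  cmeasurable (fun x => f x * g x).
Proof.
move=> [fr fi] [gr gi]; split.
- under eq_fun do rewrite Re_mul.
  by apply: measurable_funB; exact: measurable_funM.
- under eq_fun do rewrite Im_mul.
  by apply: measurable_funD; exact: measurable_funM.
Qed.

Lemma cmeasurableN f : cmeasurable f -> cmeasurable (fun x => - f x).
Proof.
move=> [fr fi]; split.
- by under eq_fun do rewrite Re_opp; exact: measurableT_comp.
- by under eq_fun do rewrite Im_opp; exact: measurableT_comp.
Qed.

Lemma cmeasurable_conj f : cmeasurable f -> cmeasurable (fun x => (f x)^*).
Proof.
move=> [fr fi]; split.
- by under eq_fun do rewrite Re_conj.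
- by under eq_fun do rewrite Im_conj; exact: measurableT_comp.
Qed.

Lemma cmeasurableB f g : cmeasurable f -> cmeasurable g ->
  cmeasurable (fun x => f x - g x).
Proof. by move=> mf mg; apply: cmeasurableD => //; exact: cmeasurableN. Qed.

Lemma cmeasurable_sum (I : Type) (s : seq I) (F : I -> T -> R[i]) :
  (forall i, cmeasurable (F i)) -> cmeasurable (fun x => \sum_(i <- s) F i x).
Proof.
move=> mF; elim: s => [|i s ih].
  by under eq_fun do rewrite big_nil; exact: cmeasurable_cst.
by under eq_fun do rewrite big_cons; exact: cmeasurableD.
Qed.

Lemma measurable_csq f : cmeasurable f -> measurable_fun setT (fun x => csq (f x)).
Proof.
by move=> [fr fi]; apply: measurable_funD; exact: measurable_funX.
Qed.

Variable P : probability T R.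
Local Notation N := (L2norm2 P).

Lemma L2norm2_ge0 f : (0 <= N f)%E.
Proof. by apply: integral_ge0 => x _; rewrite lee_fin csq_ge0. Qed.

Lemma L2norm2D_le (c : R) f g : 0 < c -> cmeasurable f -> cmeasurable g ->
  (N (fun x => f x + g x)%R <= (1 + c)%:E * N f + (1 + c^-1)%:E * N g)%E.
Proof.
move=> c0 mf mg.
have c1 : 0 <= 1 + c by rewrite addr_ge0// ltW.
have c2 : 0 <= 1 + c^-1 by rewrite addr_ge0// ltW// invr_gt0.
have mE (h : T -> R[i]) : cmeasurable h -> measurable_fun setT (fun x => (csq (h x))%:E).
  by move=> mh; apply/measurable_EFinP; exact: measurable_csq.
have mEZ (h : T -> R[i]) (k : R) : cmeasurable h -> measurable_fun setT (fun x => k%:E * (csq (h x))%:E)%E.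
  by move=> mh; apply: emeasurable_funM; [exact: measurable_cst|exact: mE].
rewrite /L2norm2 -!ge0_integralZl//;
  try (by move=> x _; rewrite lee_fin csq_ge0); try exact: mE.
rewrite -ge0_integralD//; try (by move=> x _; rewrite mule_ge0// lee_fin csq_ge0);
  try exact: mEZ.
apply: ge0_le_integral => //.
- by move=> x _; rewrite lee_fin csq_ge0.
- by apply: mE; exact: cmeasurableD.
- by apply: emeasurable_funD; exact: mEZ.
- by move=> x _; rewrite -!EFinM -EFinD lee_fin csqD_le.
Qed.

Lemma L2norm2Z (a : R[i]) f : cmeasurable f ->
  N (fun x => a * f x) = ((csq a)%:E * N f)%E.
Proof.
move=> mf; rewrite /L2norm2 -ge0_integralZl//.
- by under eq_integral do rewrite csqM EFinM.
- by apply/measurable_EFinP; exact: measurable_csq.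
- by move=> x _; rewrite lee_fin csq_ge0.
- by rewrite lee_fin csq_ge0.
Qed.

Lemma L2norm2B_sym f g : N (fun x => f x - g x) = N (fun x => g x - f x).
Proof.
by apply: eq_integral => x _; rewrite -csqN opprB.
Qed.

Lemma L2norm2_fin f : L2 P f -> N f \is a fin_num.
Proof.
by move=> [_ lty]; rewrite ge0_fin_numE//; exact: L2norm2_ge0.
Qed.

Lemma L2_linear (a b : R[i]) f g : L2 P f -> L2 P g ->
  L2 P (fun x => a * f x + b * g x).
Proof.
move=> [mf lf] [mg lg].
have mZ (k : R[i]) (h : T -> R[i]) : cmeasurable h -> cmeasurable (fun x => k * h x).
  by move=> mh; apply: cmeasurableM => //; exact: cmeasurable_cst.
split; first by apply: cmeasurableD; exact: mZ.
have := L2norm2D_le ltr01 (mZ a _ mf) (mZ b _ mg).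
move/le_lt_trans; apply; rewrite !L2norm2Z//.
rewrite -(fineK (L2norm2_fin (conj mf lf))) -(fineK (L2norm2_fin (conj mg lg))).
by rewrite -!EFinM -EFinD ltry.
Qed.

End L2Theory.

(** * Linearity of the complex integral *)

Section ComplexIntegral.
Context {R : realType} d (T : measurableType d) (P : probability T R).
Implicit Types f g : T -> R[i].

Definition cintegrable f : Prop :=
  P.-integrable setT (EFin \o (fun x => complex.Re (f x))) /\
  P.-integrable setT (EFin \o (fun x => complex.Im (f x))).

Lemma cintegrable_bounded f : cmeasurable f -> (forall x, csq (f x) <= 1) ->
  cintegrable f.
Proof.
move=> [mr mi] f1.
have bnd (h : T -> R) : measurable_fun setT h -> (forall x, h x ^+ 2 <= 1) ->
    P.-integrable setT (EFin \o h).
  move=> mh h1; apply: measurable_bounded_integrable => //.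
    exact: le_lt_trans (probability_le1 P measurableT) (ltry 1).
  exists 1; split; first exact: num_real.
  move=> M M1 x _ /=; apply: le_trans (ltW M1).
  by rewrite -(@ler_pXn2r _ 2)// ?nnegrE// ?ler01// expr1n real_normK// num_real.
split; apply: bnd => // x; apply: le_trans (f1 x); rewrite /csq.
  by rewrite lerDl sqr_ge0.
by rewrite lerDr sqr_ge0.
Qed.

Lemma cintegrableD f g : cintegrable f -> cintegrable g ->
  cintegrable (fun x => f x + g x).
Proof.
move=> [fr fi] [gr gi]; split.
- have := integrableD measurableT fr gr.
  by apply: eq_integrable => // x _; rewrite /= Re_add EFinD.
- have := integrableD measurableT fi gi.
  by apply: eq_integrable => // x _; rewrite /= Im_add EFinD.
Qed.

Lemma cintegrableZ (a : R[i]) f : cintegrable f -> cintegrable (fun x => a * f x).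
Proof.
move=> [fr fi]; split.
- have := integrableB measurableT (integrableZl measurableT (complex.Re a) fr)
    (integrableZl measurableT (complex.Im a) fi).
  by apply: eq_integrable => // x _; rewrite /= Re_mul EFinB.
- have := integrableD measurableT (integrableZl measurableT (complex.Re a) fi)
    (integrableZl measurableT (complex.Im a) fr).
  by apply: eq_integrable => // x _; rewrite /= Im_mul EFinD.
Qed.

Lemma cintD f g : cintegrable f -> cintegrable g ->
  cint P (fun x => f x + g x) = cint P f + cint P g.
Proof.
move=> [fr fi] [gr gi]; apply: complex_ext; rewrite !complexRI /cint /=.
- by under eq_Rintegral do rewrite Re_add; rewrite RintegralD.
- by under eq_Rintegral do rewrite Im_add; rewrite RintegralD.
Qed.

Lemma cintZ (a : R[i]) f : cintegrable f -> cint P (fun x => a * f x) = a * cint P f.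
Proof.
move=> [fr fi].
have ZI (k : R) (h : T -> R) : P.-integrable setT (EFin \o h) ->
    P.-integrable setT (EFin \o (fun x => k * h x)).
  by move=> ih; have := integrableZl measurableT k ih;
    apply: eq_integrable => // x _; rewrite /= EFinM.
apply: complex_ext; rewrite !complexRI /cint /=.
- under eq_Rintegral do rewrite Re_mul.
  by rewrite RintegralB//; try exact: ZI; rewrite !RintegralZl.
- under eq_Rintegral do rewrite Im_mul.
  by rewrite RintegralD//; try exact: ZI; rewrite !RintegralZl.
Qed.

Lemma cint0 : cint P (fun _ => 0) = 0.
Proof.
by apply: complex_ext; rewrite /cint /= Rintegral_cst// mul0r.
Qed.

Lemma cintegrable_sum (I : Type) (s : seq I) (F : I -> T -> R[i]) :
  (forall i, cintegrable (F i)) -> cintegrable (fun x => \sum_(i <- s) F i x).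
Proof.
move=> iF; elim: s => [|i s ih].
  under eq_fun do rewrite big_nil.
  by apply: cintegrable_bounded => [|x]; [exact: cmeasurable_cst|];
    rewrite /csq /= expr0n addr0 ler01.
by under eq_fun do rewrite big_cons; exact: cintegrableD.
Qed.

Lemma cint_sum (I : Type) (s : seq I) (F : I -> T -> R[i]) :
  (forall i, cintegrable (F i)) ->
  cint P (fun x => \sum_(i <- s) F i x) = \sum_(i <- s) cint P (F i).
Proof.
move=> iF; elim: s => [|i s ih].
  by under eq_fun do rewrite big_nil; rewrite big_nil cint0.
under eq_fun do rewrite big_cons.
by rewrite cintD ?big_cons ?ih//; exact: cintegrable_sum.
Qed.

Lemma cint1 : cint P (fun _ => 1) = 1.
Proof.
have PT : fine (P [set: T]) = 1 by exact: (congr1 fine (probability_setT P)).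
by apply: complex_ext; rewrite /cint /= Rintegral_cst// ?mul0r// mul1r.
Qed.

End ComplexIntegral.

(** * Finite combinations of functions of modulus one *)

Section UnimodularSystem.
Context {R : realType} d (T : measurableType d) (P : probability T R).
Context (I : Type) (E : I -> T -> R[i]).
Hypothesis mE : forall i, cmeasurable (E i).
Hypothesis E1 : forall i x, csq (E i x) = 1.

(** An index may occur several times in the list, so that concatenation is addition of
    combinations. *)
Definition lincomb (s : seq (R[i] * I)) : T -> R[i] :=
  fun x => \sum_(p <- s) p.1 * E p.2 x.

Lemma cmeasurable_lincomb s : cmeasurable (lincomb s).
Proof.
by apply: cmeasurable_sum => p; apply: cmeasurableM => //; exact: cmeasurable_cst.
Qed.

Lemma cinner_diag i : cinner P (E i) (E i) = 1.
Proof.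
by rewrite /cinner; under eq_fun do rewrite mul_conj_csq//; exact: cint1.
Qed.

Lemma cintegrable_inner i j : cintegrable P (fun x => E i x * (E j x)^*).
Proof.
apply: cintegrable_bounded => [|x].
  by apply: cmeasurableM => //; exact: cmeasurable_conj.
by rewrite csqM E1 mul1r /csq !complexRI sqrrN -/(csq _) E1.
Qed.

Lemma lincomb_mul_conj (s t : seq (R[i] * I)) :
  (fun x => lincomb s x * (lincomb t x)^*) = (fun x =>
    \sum_(p <- s) \sum_(q <- t) p.1 * q.1^* * (E p.2 x * (E q.2 x)^*)).
Proof.
apply/funext => x; rewrite /lincomb mulr_suml; apply: eq_bigr => p _.
by rewrite rmorph_sum mulr_sumr; apply: eq_bigr => q _; rewrite rmorphM mulrACA.
Qed.

Lemma cinner_lincomb (s t : seq (R[i] * I)) :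
  cinner P (lincomb s) (lincomb t) =
  \sum_(p <- s) \sum_(q <- t) p.1 * q.1^* * cinner P (E p.2) (E q.2).
Proof.
have iZ (p q : R[i] * I) :
    cintegrable P (fun x => p.1 * q.1^* * (E p.2 x * (E q.2 x)^*)).
  by apply: cintegrableZ; exact: cintegrable_inner.
rewrite /cinner lincomb_mul_conj cint_sum => [|p]; last exact: cintegrable_sum.
apply: eq_bigr => p _; rewrite cint_sum//; apply: eq_bigr => q _.
by rewrite cintZ//; exact: cintegrable_inner.
Qed.

(** [cint] truncates infinite integrals through [fine], so the equality rests on integrability of
    |lincomb s|^2, which follows from boundedness of the products of the [E i]. Finiteness of the
    norm is a by-product. *)
Lemma L2norm2_lincomb s : L2norm2 P (lincomb s) =
  (complex.Re (cinner P (lincomb s) (lincomb s)))%:E.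
Proof.
rewrite /cinner /cint /= /Rintegral fineK.
  by apply: eq_integral => x _; rewrite csq_mul_conj.
apply: integrable_fin_num => //.
suff [] : cintegrable P (fun x => lincomb s x * (lincomb s x)^*) by [].
rewrite lincomb_mul_conj; do 2 (apply: cintegrable_sum => ?).
by apply: cintegrableZ; exact: cintegrable_inner.
Qed.

Lemma L2_lincomb s : L2 P (lincomb s).
Proof. by split; [exact: cmeasurable_lincomb|rewrite L2norm2_lincomb ltry]. Qed.

Lemma lincomb_cat s t x : lincomb (s ++ t) x = lincomb s x + lincomb t x.
Proof. by rewrite /lincomb big_cat. Qed.

Definition scale_comb (a : R[i]) (s : seq (R[i] * I)) := [seq (a * p.1, p.2) | p <- s].

Lemma lincomb_scale a s x : lincomb (scale_comb a s) x = a * lincomb s x.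
Proof.
by rewrite /lincomb big_map mulr_sumr; apply: eq_bigr => p _ /=; rewrite mulrA.
Qed.

End UnimodularSystem.

(** * Completeness of L2 over a probability space *)

Section RieszFischer.
Context {R : realType} d (T : measurableType d) (P : probability T R).

(** The increments have L2 norm at most 2^-k, hence L1 norm at most 2^-k; their absolute values then
    have a sum of finite integral, which is finite almost everywhere, and there the telescoping
    series converges absolutely. *)
Lemma ae_cvg_L2_fast (u : nat -> T -> R) :
  (forall k, measurable_fun setT (u k)) ->
  (forall k, \int[P]_x (((u k.+1 x - u k x) ^+ 2)%:E) <= (2^-1 ^+ k ^+ 2)%:E)%E ->
  \forall x \ae P, cvgn (fun k => u k x).
Proof.
move=> mu u_fast.
pose D k x : R := `|u k.+1 x - u k x|.
have mB k : measurable_fun setT (fun x => u k.+1 x - u k x) by exact: measurable_funB.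
have mD k : measurable_fun setT (fun x => (D k x)%:E).
  by apply/measurable_EFinP; apply: measurableT_comp => //; exact: mB.
have D0 k x : (0 <= (D k x)%:E)%E by rewrite lee_fin normr_ge0.
(* AM-GM: [|t| <= c / 2 + t^2 / (2 c)] with [c = 2^-k] bounds the L1 norm by the L2 norm *)
have intD k : (\int[P]_x (D k x)%:E <= (2^-1 ^+ k)%:E)%E.
  set c : R := 2^-1 ^+ k.
  have c0 : 0 < c by rewrite exprn_gt0// invr_gt0.
  have mS : measurable_fun setT (fun x => ((u k.+1 x - u k x) ^+ 2)%:E).
    by apply/measurable_EFinP; exact: measurable_funX.
  have cV : 0 <= (2 * c)^-1 by rewrite invr_ge0 mulr_ge0// ltW.
  have h0 : 0 <= c / 2 by rewrite divr_ge0// ltW.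
  have mSZ : measurable_fun setT
      (fun x => ((2 * c)^-1)%:E * ((u k.+1 x - u k x) ^+ 2)%:E)%E.
    by apply: emeasurable_funM => //; exact: measurable_cst.
  apply: (@le_trans _ _ (\int[P]_x ((c / 2)%:E +
      ((2 * c)^-1)%:E * ((u k.+1 x - u k x) ^+ 2)%:E))%E).
    apply: ge0_le_integral => //.
      by apply: emeasurable_funD => //; exact: measurable_cst.
    move=> x _; rewrite -EFinM -EFinD lee_fin /D.
    set t := u k.+1 x - u k x.
    rewrite -subr_ge0 -(real_normK (num_real t)).
    have -> : c / 2 + (2 * c)^-1 * `|t| ^+ 2 - `|t| = (2 * c)^-1 * (c - `|t|) ^+ 2.
      by field; rewrite gt_eqF.
    by rewrite mulr_ge0 ?sqr_ge0.
  rewrite ge0_integralD//; last first.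
    by move=> x _; rewrite mule_ge0// lee_fin// sqr_ge0.
  rewrite ge0_integralZl//; last by move=> x _; rewrite lee_fin sqr_ge0.
  rewrite integral_cst// [X in (_ * X)%E](_ : _ = 1%E); last exact: probability_setT.
  apply: (@le_trans _ _ ((c / 2)%:E * 1 + ((2 * c)^-1)%:E * (c ^+ 2)%:E)%E).
    by rewrite leeD2l// lee_wpmul2l// lee_fin.
  rewrite mule1 -EFinM -EFinD lee_fin le_eqVlt; apply/orP; left; apply/eqP.
  by field; rewrite gt_eqF.
have mSer : measurable_fun setT (fun x => \sum_(0 <= k <oo) (D k x)%:E)%E.
  exact: ge0_emeasurable_sum.
have intSer : (\int[P]_x (\sum_(0 <= k <oo) (D k x)%:E) < +oo)%E.
  rewrite integral_nneseries//.
  (* This is 2^-k, written in the shape of the geometric series to be summed. *)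
  apply: (@le_lt_trans _ _ (\sum_(0 <= k <oo) (2 / (2 ^ (k + 1))%:R)%:E)%E).
    apply: lee_nneseries => [k _ _|k _]; first exact: integral_ge0.
    apply: le_trans (intD k) _; rewrite lee_fin natrX addn1 exprS exprVn.
    by rewrite invfM mulrA divff// mul1r.
  have /cvg_lim -> // := @cvg_geometric_eseries_half R 2 0.
  by rewrite ltry.
have : P.-integrable setT (fun x => \sum_(0 <= k <oo) (D k x)%:E)%E.
  apply/integrableP; split=> //; apply: le_lt_trans intSer.
  rewrite le_eqVlt; apply/orP; left; apply/eqP; apply: eq_integral => x _.
  by rewrite gee0_abs// nneseries_ge0.
move/(integrable_ae measurableT); apply: filterS => x /(_ I) sfin.
rewrite (_ : (fun k => u k x) =
    (fun k => u 0%N x + series (telescope (u ^~ x)) k)); last first.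
  by apply/funext => k; exact: (eq_sum_telescope (u ^~ x)).
apply: is_cvgD; first exact: is_cvg_cst.
apply: normed_cvg; apply: nondecreasing_is_cvgn.
  by apply: nondecreasing_series => k _ _ /=; rewrite normr_ge0.
exists (fine (\sum_(0 <= k <oo) (D k x)%:E)%E) => _ [m _ <-].
rewrite -lee_fin fineK// /series /= -sumEFin.
exact: nneseries_lim_ge.
Qed.

(** The upper limit exists at every point and is measurable, whatever the set of convergence; [fine]
    only alters it where it is infinite. *)
Lemma measurable_ae_limit (u : nat -> T -> R) :
  (forall k, measurable_fun setT (u k)) ->
  exists2 v : T -> R, measurable_fun setT v &
    forall x, cvgn (fun k => u k x) -> u k x @[k --> \oo] --> v x.
Proof.
move=> mu; exists (fun x => fine (limn_esup (fun k => (u k x)%:E))).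
  apply: measurableT_comp; first exact: fine_measurable.
  by apply: measurable_fun_limn_esup => k; apply/measurable_EFinP.
move=> x cu.
have /cvg_limn_einf_sup [_ ->] : (u k x)%:E @[k --> \oo] --> (limn (u ^~ x))%:E.
  by apply: cvg_EFin => //; exact: nearW.
exact: cu.
Qed.

(* A fast L2-Cauchy sequence converges almost everywhere; Fatou upgrades this to L2. *)
Lemma riesz_fischer (G : nat -> T -> R[i]) :
  (forall k, cmeasurable (G k)) ->
  (forall k, L2norm2 P (fun x => G k.+1 x - G k x)%R <= (2^-1 ^+ k ^+ 2)%:E)%E ->
  exists2 F : T -> R[i], cmeasurable F &
    forall k, (L2norm2 P (fun x => F x - G k x)%R <= (4 * (2^-1 ^+ k ^+ 2))%:E)%E.
Proof.
move=> mG G_fast.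
have mGr k := (mG k).1; have mGi k := (mG k).2.
have mC k := measurable_csq (cmeasurableB (mG k.+1) (mG k)).
have cr : \forall x \ae P, cvgn (fun k => complex.Re (G k x)).
  apply: ae_cvg_L2_fast => // k; apply: le_trans (G_fast k).
  apply: ge0_le_integral => //.
  - by move=> x _; rewrite lee_fin sqr_ge0.
  - by apply/measurable_EFinP; apply: measurable_funX; exact: measurable_funB.
  - by apply/measurable_EFinP; exact: mC.
  - by move=> x _; rewrite lee_fin /csq !complexRI lerDl sqr_ge0.
have ci : \forall x \ae P, cvgn (fun k => complex.Im (G k x)).
  apply: ae_cvg_L2_fast => // k; apply: le_trans (G_fast k).
  apply: ge0_le_integral => //.
  - by move=> x _; rewrite lee_fin sqr_ge0.
  - by apply/measurable_EFinP; apply: measurable_funX; exact: measurable_funB.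
  - by apply/measurable_EFinP; exact: mC.
  - by move=> x _; rewrite lee_fin /csq !complexRI lerDr sqr_ge0.
have [vr mvr cvr] := measurable_ae_limit mGr.
have [vi mvi cvi] := measurable_ae_limit mGi.
exists (fun x => (vr x +i* vi x)%C); first by split.
(* The increment from k to k + 1 is split off, so that the rest starts at k + 1 with a bound four
   times smaller. With c = 2^-k the constant 4 reproduces itself: 2 * 4(c/2)^2 + 2c^2 = 4c^2. *)
have step m k : (L2norm2 P (fun x => G (k + m)%N x - G k x)%R <= (4 * (2^-1 ^+ k ^+ 2))%:E)%E.
  elim: m k => [|m ih] k.
    rewrite addn0 /L2norm2 integral0_eq ?lee_fin ?mulr_ge0 ?sqr_ge0// => x _.
    by rewrite subrr /csq /= expr0n /= addr0.
  rewrite (_ : (fun x => _) = (fun x => (G (k.+1 + m)%N x - G k.+1 x) + (G k.+1 x - G k x)));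
    last by apply/funext => x; rewrite addnS addSn; ring.
  apply: le_trans (L2norm2D_le P ltr01 (cmeasurableB (mG _) (mG _))
    (cmeasurableB (mG _) (mG _))) _.
  apply: (@le_trans _ _ ((1 + 1)%:E * (4 * (2^-1 ^+ k.+1 ^+ 2))%:E +
      (1 + 1^-1)%:E * (2^-1 ^+ k ^+ 2)%:E)%E).
    by rewrite leeD// lee_wpmul2l// ?lee_fin ?addr_ge0 ?invr_ge0.
  rewrite -!EFinM -EFinD lee_fin le_eqVlt; apply/orP; left; apply/eqP.
  by rewrite (exprS _ k); set c := 2^-1 ^+ k; field.
move=> k.
have -> : L2norm2 P (fun x => (vr x +i* vi x)%C - G k x)%R =
    (\int[P]_x limn_einf (fun j => (csq (G (k + j)%N x - G k x))%:E))%E.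
  apply: ge0_ae_eq_integral => //.
  - apply/measurable_EFinP; apply: measurable_csq; apply: cmeasurableB => //.
  (* The lower limit is minus the upper limit of the negatives, whose measurability is available. *)
  - under eq_fun do rewrite -[limn_einf _]oppeK -limn_esupN.
    apply: measurableT_comp => //; apply: measurable_fun_limn_esup => j.
    apply: measurableT_comp => //; apply/measurable_EFinP.
    by apply: measurable_csq; exact: cmeasurableB.
  - by move=> x _; rewrite lee_fin csq_ge0.
  - move=> x _; rewrite limn_einf_lim; apply: lime_ge; first exact: is_cvg_einfs.
    by apply: nearW => j; apply: le_ereal_inf_tmp => _ [i _ <-]; rewrite lee_fin csq_ge0.
  - apply: filterS2 cr ci => x /cvr cx /cvi dx _.
    apply/esym/(cvg_limn_einf_sup _).1.
    apply: cvg_EFin; first exact: nearW.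
    rewrite /csq; under eq_fun do rewrite !complexRI.
    rewrite /= !complexRI /=.
    have shift (w : nat -> R) (l : R) : w j @[j --> \oo] --> l -> w (k + j)%N @[j --> \oo] --> l.
      rewrite -(cvg_shiftn k w) => wl; apply: cvg_trans wl.
      by apply: near_eq_cvg; apply: nearW => j; rewrite addnC.
    have sq (w : nat -> R) (l : R) : w j @[j --> \oo] --> l ->
        (w j) ^+ 2 @[j --> \oo] --> l ^+ 2.
      by move=> wl; under eq_fun do rewrite expr2; rewrite expr2; exact: cvgM.
    by apply: cvgD; apply: sq; (apply: cvgB; last exact: cvg_cst);
      [exact: (shift (fun j => complex.Re (G j x)))|
       exact: (shift (fun j => complex.Im (G j x)))].
apply: le_trans (fatou _ _ _ _) _ => //.
- move=> j; apply/measurable_EFinP; apply: measurable_csq; exact: cmeasurableB.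
- by move=> j x _; rewrite lee_fin csq_ge0.
- rewrite limn_einf_lim; apply: lime_le; first exact: is_cvg_einfs.
  apply: nearW => j; apply: le_trans (step j k).
  by apply: ereal_inf_lbound; exists j => //=.
Qed.

End RieszFischer.

(** * Comparison of norms on two spaces through approximants *)

Section Approximation.
Context {R : realType} d d' (T : measurableType d) (T' : measurableType d').
Variables (P : probability T R) (P' : probability T' R).

(** Passing from [f] to [h] and from [h'] to [g] costs a factor 1 + c each, plus an error
    proportional to e. With c fixed, e tends to 0; then c tends to 0. *)
Lemma L2norm2_le_of_approx (f : T -> R[i]) (g : T' -> R[i]) :
  L2 P f -> L2 P' g ->
  (forall e : R, 0 < e -> exists h h', [/\ L2 P h, L2 P' h',
     L2norm2 P h = L2norm2 P' h',
     (L2norm2 P (fun x => f x - h x)%R < e%:E)%E &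
     (L2norm2 P' (fun x => g x - h' x)%R < e%:E)%E]) ->
  (L2norm2 P f <= L2norm2 P' g)%E.
Proof.
move=> f2 g2 approx.
rewrite -(fineK (L2norm2_fin f2)) -(fineK (L2norm2_fin g2)) lee_fin.
set x := fine _; set y := fine _.
have y0 : 0 <= y by rewrite fine_ge0// L2norm2_ge0.
have bound (c e : R) : 0 < c -> 0 < e ->
    x <= (1 + c) ^+ 2 * y + (2 + c) * (1 + c^-1) * e.
  move=> c0 e0; have [h [h' [h2 h'2 hh' fh gh']]] := approx e e0.
  have c1 : 0 <= 1 + c by rewrite addr_ge0// ltW.
  have c2 : 0 <= 1 + c^-1 by rewrite addr_ge0// ltW// invr_gt0.
  have I1 : (L2norm2 P f <= (1 + c)%:E * L2norm2 P h + (1 + c^-1)%:E * e%:E)%E.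
    rewrite [X in L2norm2 P X](_ : f = fun x => h x + (f x - h x)); last first.
      by apply/funext => z; ring.
    apply: le_trans (L2norm2D_le P c0 h2.1 (cmeasurableB f2.1 h2.1)) _.
    by rewrite leeD2l// lee_wpmul2l ?lee_fin// ltW.
  have I2 : (L2norm2 P' h' <= (1 + c)%:E * L2norm2 P' g + (1 + c^-1)%:E * e%:E)%E.
    rewrite [X in L2norm2 P' X](_ : h' = fun x => g x + (h' x - g x)); last first.
      by apply/funext => z; ring.
    apply: le_trans (L2norm2D_le P' c0 g2.1 (cmeasurableB h'2.1 g2.1)) _.
    by rewrite leeD2l// lee_wpmul2l ?lee_fin// L2norm2B_sym ltW.
  move: I1 I2; rewrite hh' -(fineK (L2norm2_fin f2)) -(fineK (L2norm2_fin g2)).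
  rewrite -(fineK (L2norm2_fin h'2)) -/x -/y -!EFinM -!EFinD !lee_fin.
  set z := fine _ => I1 I2.
  apply: le_trans I1 _; rewrite -lerBrDr.
  apply: le_trans (ler_wpM2l c1 I2) _; rewrite le_eqVlt; apply/orP; left; apply/eqP.
  by ring.
have bound' (c : R) : 0 < c -> x <= (1 + c) ^+ 2 * y.
  move=> c0; apply/ler_addgt0Pl => e e0.
  have k0 : 0 < (2 + c) * (1 + c^-1) by rewrite mulr_gt0// addr_gt0// invr_gt0.
  have := bound c (e / ((2 + c) * (1 + c^-1))) c0 (divr_gt0 e0 k0).
  by rewrite mulrCA divff ?gt_eqF// mulr1 addrC.
apply/ler_addgt0Pl => e e0.
have k0 : 0 < 3 * y + 1 + e by rewrite ltr_wpDl// addr_ge0// mulr_ge0.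
(* The summand e in the denominator gives c <= 1, hence (1 + c)^2 y <= y + 3cy, and 3cy <= e by the
   first summand. *)
pose c := e / (3 * y + 1 + e).
have c0 : 0 < c by rewrite divr_gt0.
have ck : c * (3 * y + 1 + e) = e by rewrite /c divfK// gt_eqF.
have c1 : c <= 1 by rewrite ler_pdivrMr// mul1r lerDr addr_ge0// mulr_ge0.
apply: le_trans (bound' c c0) _.
have c2y : c ^+ 2 * y <= c * y by rewrite ler_wpM2r// expr2 ler_piMr// ltW.
have : 0 <= c * (1 + e) by rewrite mulr_ge0// ?addr_ge0// ltW.
have -> : (1 + c) ^+ 2 * y = y + 2 * (c * y) + c ^+ 2 * y by ring.
nra.
Qed.

End Approximation.

(** * Distance zero as equality in L2 *)

Section Distance.
Context {R : realType} d (T : measurableType d) (P : probability T R).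
Implicit Types f g : T -> R[i].

Lemma L2norm2_0 : L2norm2 P (fun _ => 0 : R[i]) = 0%E.
Proof. by apply: integral0_eq => x _; rewrite /csq /= expr0n addr0. Qed.

Lemma L2dist2_refl f : L2dist2 P f f = 0%E.
Proof. by rewrite /L2dist2; under eq_fun do rewrite subrr; exact: L2norm2_0. Qed.

Lemma L2dist2_comb_le (a b : R[i]) f g f' g' :
  cmeasurable f -> cmeasurable g -> cmeasurable f' -> cmeasurable g' ->
  (L2dist2 P (fun x => a * f x + b * g x)%R (fun x => a * f' x + b * g' x)%R <=
   (2 * csq a)%:E * L2dist2 P f f' + (2 * csq b)%:E * L2dist2 P g g')%E.
Proof.
move=> mf mg mf' mg'.
have mZ (k : R[i]) (h : T -> R[i]) : cmeasurable h -> cmeasurable (fun x => k * h x).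
  by move=> mh; apply: cmeasurableM => //; exact: cmeasurable_cst.
rewrite /L2dist2 [X in L2norm2 P X](_ : _ = fun x =>
    a * (f x - f' x) + b * (g x - g' x)); last by apply/funext => x; ring.
have mff := cmeasurableB mf mf'; have mgg := cmeasurableB mg mg'.
apply: le_trans (L2norm2D_le P ltr01 (mZ a _ mff) (mZ b _ mgg)) _.
by rewrite !L2norm2Z// invr1 !EFinM !muleA.
Qed.

(** In each direction one of the two functions serves as the approximant of both, with error 0. *)
Lemma L2norm2_eq_of_dist0 f g : L2 P f -> L2 P g -> L2dist2 P f g = 0%E ->
  L2norm2 P f = L2norm2 P g.
Proof.
move=> f2 g2 fg; have gf : L2dist2 P g f = 0%E by rewrite /L2dist2 L2norm2B_sym.
apply/le_anti/andP; split; apply: L2norm2_le_of_approx => // e e0.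
- exists g, g; split=> //; first by rewrite -[X in (X < _)%E]/(L2dist2 P f g) fg.
  by rewrite -[X in (X < _)%E]/(L2dist2 P g g) L2dist2_refl.
- exists f, f; split=> //; first by rewrite -[X in (X < _)%E]/(L2dist2 P g f) gf.
  by rewrite -[X in (X < _)%E]/(L2dist2 P f f) L2dist2_refl.
Qed.

Lemma L2dist2_comb0 (a b : R[i]) f g f' g' :
  L2 P f -> L2 P g -> L2 P f' -> L2 P g' ->
  L2dist2 P f f' = 0%E -> L2dist2 P g g' = 0%E ->
  L2dist2 P (fun x => a * f x + b * g x) (fun x => a * f' x + b * g' x) = 0%E.
Proof.
move=> [mf _] [mg _] [mf' _] [mg' _] ff gg.
apply/le_anti/andP; split; last exact: L2norm2_ge0.
by apply: le_trans (L2dist2_comb_le a b mf mg mf' mg') _; rewrite ff gg !mule0 adde0.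
Qed.

End Distance.

(* Two unimodular systems with the same Gram matrix on [Lam] span isometric
   subspaces; [paired f F] is the graph of the isometry between the closures. *)
Section Transfer.
Context {R : realType} d d' (T : measurableType d) (T' : measurableType d').
Variables (P : probability T R) (P' : probability T' R).
Context (I : eqType) (E : I -> T -> R[i]) (E' : I -> T' -> R[i]) (Lam : set I).
Hypothesis mE : forall i, cmeasurable (E i).
Hypothesis mE' : forall i, cmeasurable (E' i).
Hypothesis E1 : forall i x, csq (E i x) = 1.
Hypothesis E'1 : forall i x, csq (E' i x) = 1.
Hypothesis gram : forall i j, Lam i -> Lam j ->
  cinner P (E i) (E j) = cinner P' (E' i) (E' j).

Definition comb_in (s : seq (R[i] * I)) := forall p, p \in s -> Lam p.2.

Lemma comb_in_cat s t : comb_in s -> comb_in t -> comb_in (s ++ t).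
Proof. by move=> hs ht p; rewrite mem_cat => /orP[/hs|/ht]. Qed.

Lemma comb_in_scale a s : comb_in s -> comb_in (scale_comb a s).
Proof. by move=> hs p /mapP[q /hs qs ->]. Qed.

Lemma L2norm2_lincomb_gram s : comb_in s ->
  L2norm2 P (lincomb E s) = L2norm2 P' (lincomb E' s).
Proof.
move=> hs; rewrite !L2norm2_lincomb// !cinner_lincomb//; congr (complex.Re _)%:E.
apply: eq_big_seq => p ps; apply: eq_big_seq => q qs.
by rewrite gram//; [exact: hs ps|exact: hs qs].
Qed.

(** A single list [s] has to work on both sides; separate lists would merely place [f] and [F] in
    the two closed spans. *)
Definition paired f F := [/\ L2 P f, L2 P' F & forall e : R, 0 < e ->
  exists2 s, comb_in s & (L2dist2 P f (lincomb E s) < e%:E)%E /\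
                         (L2dist2 P' F (lincomb E' s) < e%:E)%E].

Lemma paired_norm f F : paired f F -> L2norm2 P' F = L2norm2 P f.
Proof.
move=> [f2 F2 fF]; apply/le_anti/andP; split; apply: L2norm2_le_of_approx => // e e0;
  have [s hs [fs Fs]] := fF e e0.
- exists (lincomb E' s), (lincomb E s); split=> //; try exact: L2_lincomb.
  by rewrite -L2norm2_lincomb_gram.
- exists (lincomb E s), (lincomb E' s); split=> //; try exact: L2_lincomb.
  exact: L2norm2_lincomb_gram.
Qed.

Lemma paired_comb (a b : R[i]) f F g G : paired f F -> paired g G ->
  paired (fun x => a * f x + b * g x) (fun x => a * F x + b * G x).
Proof.
move=> [f2 F2 fF] [g2 G2 gG]; split; [exact: L2_linear|exact: L2_linear|] => e e0.
have k0 : 0 < 2 * (csq a + csq b + 1).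
  by rewrite mulr_gt0// ltr_wpDl// addr_ge0// csq_ge0.
(* The total error is 2(|a|^2 + |b|^2) e1 = e - 2 e1; the summand 1 makes it strictly less than e
   and keeps the denominator positive. *)
pose e1 := e / (2 * (csq a + csq b + 1)).
have e10 : 0 < e1 by rewrite divr_gt0.
have small (r s : \bar R) : (0 <= r)%E -> (r < e1%:E)%E -> (0 <= s)%E -> (s < e1%:E)%E ->
    ((2 * csq a)%:E * r + (2 * csq b)%:E * s < e%:E)%E.
  move=> r0 re s0 se.
  apply: (@le_lt_trans _ _ ((2 * csq a)%:E * e1%:E + (2 * csq b)%:E * e1%:E)%E).
    by rewrite leeD// lee_wpmul2l ?lee_fin ?mulr_ge0 ?csq_ge0// ltW.
  rewrite -!EFinM -EFinD lte_fin.
  have -> : e = e1 * (2 * (csq a + csq b + 1)) by rewrite /e1 divfK// gt_eqF.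
  nra.
have [s hs [fs Fs]] := fF e1 e10; have [t ht [gt Gt]] := gG e1 e10.
have mL := cmeasurable_lincomb mE; have mL' := cmeasurable_lincomb mE'.
exists (scale_comb a s ++ scale_comb b t).
  by apply: comb_in_cat; exact: comb_in_scale.
split.
- rewrite (_ : lincomb E _ = fun x => a * lincomb E s x + b * lincomb E t x);
    last by apply/funext => x; rewrite lincomb_cat !lincomb_scale.
  apply: le_lt_trans (L2dist2_comb_le P a b f2.1 g2.1 (mL s) (mL t)) _.
  by apply: small => //; exact: L2norm2_ge0.
- rewrite (_ : lincomb E' _ = fun x => a * lincomb E' s x + b * lincomb E' t x);
    last by apply/funext => x; rewrite lincomb_cat !lincomb_scale.
  apply: le_lt_trans (L2dist2_comb_le P' a b F2.1 G2.1 (mL' s) (mL' t)) _.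
  by apply: small => //; exact: L2norm2_ge0.
Qed.

(** By linearity [F - G] is paired with [f - f = 0], and pairs have equal norms. *)
Lemma paired_unique f F G : paired f F -> paired f G -> L2dist2 P' F G = 0%E.
Proof.
move=> fF fG; have := paired_norm (paired_comb 1 (-1) fF fG).
rewrite (_ : (fun x => 1 * F x + -1 * G x) = fun x => F x - G x); last first.
  by apply/funext => x; ring.
rewrite /L2dist2 => ->; rewrite (_ : (fun x => _) = fun=> 0) ?L2norm2_0//.
by apply/funext => x; ring.
Qed.

Lemma paired_gen i : Lam i -> paired (E i) (E' i).
Proof.
move=> Li.
have eE : lincomb E [:: (1, i)] = E i.
  by apply/funext => x; rewrite /lincomb big_seq1 mul1r.
have eE' : lincomb E' [:: (1, i)] = E' i.
  by apply/funext => x; rewrite /lincomb big_seq1 mul1r.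
split; [by rewrite -eE; exact: L2_lincomb|by rewrite -eE'; exact: L2_lincomb|] => e e0.
exists [:: (1, i)]; first by move=> p; rewrite inE => /eqP ->.
by rewrite eE eE' !L2dist2_refl.
Qed.

(** Combinations approximating [f] form a Cauchy sequence; the Gram matrix carries their distances
    over to the second space, where completeness yields [F]. *)
Lemma paired_total f : L2 P f ->
  (forall e : R, 0 < e -> exists2 s, comb_in s & (L2dist2 P f (lincomb E s) < e%:E)%E) ->
  exists F, paired f F.
Proof.
move=> f2 fE.
have half0 k : 0 < 2^-1 ^+ k :> R by rewrite exprn_gt0// invr_gt0.
(* The exponent k + 1 pays for the two applications of the factor 2: with c = 2^-k, consecutive
   combinations are at squared distance at most 2(c/4)^2 + 2(c/2)^2 = 5c^2/8, below the c^2 that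
   [riesz_fischer] asks for. *)
have /choice[s hs] k : exists s, comb_in s /\
    (L2dist2 P f (lincomb E s) < (2^-1 ^+ k.+1 ^+ 2)%:E)%E.
  have [|s hs fs] := fE (2^-1 ^+ k.+1 ^+ 2); first by rewrite exprn_gt0.
  by exists s.
have mL := cmeasurable_lincomb mE; have mL' := cmeasurable_lincomb mE'.
have fast k : (L2norm2 P' (fun x => lincomb E' (s k.+1) x - lincomb E' (s k) x)%R <=
    (2^-1 ^+ k ^+ 2)%:E)%E.
  have -> : (fun x => lincomb E' (s k.+1) x - lincomb E' (s k) x) =
      lincomb E' (s k.+1 ++ scale_comb (-1) (s k)).
    by apply/funext => x; rewrite lincomb_cat lincomb_scale mulN1r.
  rewrite -L2norm2_lincomb_gram; last first.
    by apply: comb_in_cat; [exact: (hs _).1|apply: comb_in_scale; exact: (hs _).1].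
  have -> : lincomb E (s k.+1 ++ scale_comb (-1) (s k)) =
      (fun x => (lincomb E (s k.+1) x - f x) + (f x - lincomb E (s k) x)).
    by apply/funext => x; rewrite lincomb_cat lincomb_scale; ring.
  apply: le_trans (L2norm2D_le P ltr01 (cmeasurableB (mL _) f2.1)
    (cmeasurableB f2.1 (mL _))) _.
  rewrite L2norm2B_sym.
  apply: (@le_trans _ _ ((1 + 1)%:E * (2^-1 ^+ k.+2 ^+ 2)%:E +
      (1 + 1^-1)%:E * (2^-1 ^+ k.+1 ^+ 2)%:E)%E).
    by rewrite leeD// lee_wpmul2l ?lee_fin ?addr_ge0 ?invr_ge0// ltW//; exact: (hs _).2.
  rewrite -!EFinM -EFinD lee_fin invr1 (exprS _ k.+1) (exprS _ k).
  have := sqr_ge0 (2^-1 ^+ k : R); set c := 2^-1 ^+ k.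
  have -> : (1 + 1) * (2^-1 * (2^-1 * c)) ^+ 2 + (1 + 1) * (2^-1 * c) ^+ 2 =
    5 / 8 * c ^+ 2 by field.
  lra.
have [F mF Flim] := riesz_fischer (fun k => mL' (s k)) fast.
exists F; split=> //.
  split=> //.
  rewrite (_ : F = fun x => (F x - lincomb E' (s 0%N) x) + lincomb E' (s 0%N) x);
    last by apply/funext => x; ring.
  apply: le_lt_trans (L2norm2D_le P' ltr01 (cmeasurableB mF (mL' _)) (mL' _)) _.
  rewrite -(fineK (L2norm2_fin (L2_lincomb P' mE' E'1 (s 0%N)))) -EFinM.
  rewrite lte_add_pinfty ?ltry//.
  apply: le_lt_trans (lee_wpmul2l _ (Flim 0%N)) _; first by rewrite lee_fin addr_ge0.
  by rewrite -EFinM ltry.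
move=> e e0.
(* Some 2^-k lies below e/4, and its square is no larger. This k serves both sides, as the error at
   [f] is smaller still. *)
have [k kE] : exists k, 4 * (2^-1 ^+ k ^+ 2) < e.
  have : (2^-1 : R) ^+ k @[k --> \oo] --> 0.
    by apply: cvg_expr; rewrite ger0_norm ?invr_ge0// invf_lt1// ltr1n.
  move/cvgrPdist_lt => /(_ (e / 4) (divr_gt0 e0 (ltr0Sn _ _)))[k _ /(_ k (leqnn k))].
  rewrite /= sub0r normrN gtr0_norm// ltr_pdivlMr// => ke; exists k.
  apply: le_lt_trans ke; rewrite mulrC ler_wpM2r// expr2 ler_piMr ?(ltW (half0 k))//.
  by rewrite exprn_ile1// ?invr_ge0// invf_le1// ler1n.
exists (s k); first exact: (hs k).1.
split; last by apply: le_lt_trans (Flim k) _; rewrite lte_fin.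
apply: lt_trans (hs k).2 _; rewrite lte_fin; apply: le_lt_trans kE.
rewrite (exprS _ k); set c := 2^-1 ^+ k.
by have := sqr_ge0 c; rewrite exprMn; nra.
Qed.

End Transfer.

(** * Two-term norms and Bessel's inequality *)

Section UnimodularGeometry.
Context {R : realType} d (T : measurableType d) (P : probability T R).
Context (I : eqType) (E : I -> T -> R[i]).
Hypothesis mE : forall i, cmeasurable (E i).
Hypothesis E1 : forall i x, csq (E i x) = 1.

Lemma cinner_sym i j : cinner P (E j) (E i) = (cinner P (E i) (E j))^*.
Proof.
have [_ iI] := cintegrable_inner P mE E1 i j.
apply: complex_ext; rewrite !complexRI /cinner /cint /=.
  by apply: eq_Rintegral => x _; rewrite !complexRI; ring.
rewrite -mulN1r -RintegralZl//.
by apply: eq_Rintegral => x _; rewrite !complexRI; ring.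
Qed.

(** The inner product enters only through the cross term, so comparing such norms on two spaces
    compares inner products. *)
Lemma L2norm2_lincomb2 (a b : R[i]) i j :
  L2norm2 P (fun x => a * E i x + b * E j x) =
  (csq a + csq b + 2 * complex.Re (a * b^* * cinner P (E i) (E j)))%:E.
Proof.
rewrite (_ : (fun x => _) = lincomb E [:: (a, i); (b, j)]); last first.
  by apply/funext => x; rewrite /lincomb big_cons big_seq1.
rewrite L2norm2_lincomb// cinner_lincomb// !big_cons !big_nil /= !addr0.
rewrite !cinner_diag// (cinner_sym i j) !mulr1; congr _%:E.
by rewrite /csq !complexRI; ring.
Qed.

Lemma bessel_unimodular i (s : seq I) : uniq s ->
  {in s &, forall j k, j != k -> cinner P (E j) (E k) = 0} ->
  \sum_(j <- s) csq (cinner P (E i) (E j)) <= 1.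
Proof.
move=> us orth; pose c j := cinner P (E i) (E j).
(* The residual of [E i] after projection onto the [E j]; its squared norm, 1 minus the Bessel sum,
   is nonnegative. *)
pose t := (1, i) :: [seq (- c j, j) | j <- s].
have := L2norm2_ge0 P (lincomb E t).
rewrite L2norm2_lincomb// cinner_lincomb// lee_fin.
have -> : \sum_(p <- t) \sum_(q <- t) p.1 * q.1^* * cinner P (E p.2) (E q.2) =
    1 - \sum_(j <- s) c j * (c j)^*.
  rewrite /t !big_cons /= !big_map /= cinner_diag// rmorph1 !mulr1.
  have -> : \sum_(j <- s) 1 * (- c j)^* * cinner P (E i) (E j) =
      - \sum_(j <- s) c j * (c j)^*.
    by rewrite -sumrN; apply: eq_bigr => j _; rewrite rmorphN -/(c j); ring.
  rewrite -addrA; congr (_ + _); rewrite -[RHS]addr0; congr (_ + _).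
  (* Each remaining row pairs a multiple of [E j] with the residual, which is orthogonal to
     [E j]. *)
  rewrite big_seq big1// => j js.
  rewrite big_cons /= big_map (cinner_sym i j) -/(c j).
  rewrite (bigD1_seq j)//= big_seq_cond big1 => [|k /andP[ks kj]]; last first.
    by rewrite orth ?mulr0// eq_sym.
  by rewrite cinner_diag// rmorphN rmorph1; ring.
rewrite complexRI Re_opp subr_ge0.
have -> : complex.Re (\sum_(j <- s) c j * (c j)^*) = \sum_(j <- s) csq (c j).
  elim: s {us orth t} => [|j s ih]; first by rewrite !big_nil.
  by rewrite !big_cons Re_add ih -csq_mul_conj.
by [].
Qed.

End UnimodularGeometry.

(** * Exponentials on R^n *)

Section Exponentials.
Context {R : realType} {n : nat}.
Implicit Types (l t u v : 'rV[R]_n).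

Lemma expiD (a b : R) : expi (a + b) = expi a * expi b.
Proof.
by apply: complex_ext; rewrite !complexRI /= ?cosD ?sinD//; ring.
Qed.

Lemma csq_expi (a : R) : csq (expi a) = 1.
Proof. by rewrite /csq /= cos2Dsin2. Qed.

Lemma conj_expi (a : R) : (expi a)^* = expi (- a).
Proof. by apply: complex_ext; rewrite !complexRI /= ?cosN ?sinN. Qed.

Lemma dotpDl u v t : dotp (u + v) t = dotp u t + dotp v t.
Proof. by rewrite /dotp -big_split; apply: eq_bigr => i _; rewrite mxE mulrDl. Qed.

Lemma dotpNl u t : dotp (- u) t = - dotp u t.
Proof. by rewrite /dotp -sumrN; apply: eq_bigr => i _; rewrite mxE mulNr. Qed.

Lemma csq_ex l (x : 'rV[R]_n) : csq (ex l x) = 1.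
Proof. exact: csq_expi. Qed.

Lemma ex_mul_conj l l' (x : 'rV[R]_n) : ex l x * (ex l' x)^* = ex (l - l') x.
Proof.
by rewrite /ex conj_expi -expiD dotpDl dotpNl; congr expi; ring.
Qed.

Lemma cinner_ex (mu : probability (Rn R n) R) l l' :
  cinner mu (ex l) (ex l') = fourier mu (l - l').
Proof.
rewrite /cinner /fourier; congr cint; apply/funext => x; exact: ex_mul_conj.
Qed.

Lemma measurable_coord (i : 'I_n) :
  measurable_fun setT (fun x : Rn R n => (x : 'rV[R]_n) ord0 i).
Proof.
apply: (measurability _ (RGenOpens.measurableE R)) => _ [_ [a [b ->]] <-].
apply: sub_sigma_algebra; rewrite setTI.
have /continuousP := @coord_continuous R 1 n ord0 i; apply.
exact: interval_open.
Qed.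

Lemma cmeasurable_ex l : cmeasurable (ex l : Rn R n -> R[i]).
Proof.
have mdot : measurable_fun setT (fun x : Rn R n => 2 * pi * dotp l x).
  apply: measurable_funM; first exact: measurable_cst.
  apply: measurable_sum => i; apply: measurable_funM; first exact: measurable_cst.
  exact: measurable_coord.
by split; apply: measurableT_comp mdot; apply: continuous_measurable_fun;
  [exact: continuous_cos|exact: continuous_sin].
Qed.

Lemma norm_expi (a : R) : `|expi a| = 1.
Proof.
by rewrite normc_def -/(csq _) csq_expi sqrtr1.
Qed.

End Exponentials.

(** * Characters and translation invariance on the Bohr group *)

Section Bohr.
Context {R : realType} {n : nat}.
Implicit Types (l u v : 'rV[R]_n).

Lemma bohr_ext (a b : bohr R n) : (forall u, a u = b u) -> a = b.
Proof.
case: a b => [a aM a1] [b bM b1] /= /funext ab; subst b.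
by congr Bohr; exact: Prop_irrelevance.
Qed.

Lemma csq_bohr (a : bohr R n) u : csq (a u) = 1.
Proof. exact: csq_norm (bchar_norm a u). Qed.

Lemma bohr_mul_conj (a : bohr R n) u : a u * (a u)^* = 1.
Proof. exact: mul_conj_csq (csq_bohr a u). Qed.

Lemma bohr0 (a : bohr R n) : a 0 = 1.
Proof.
have := bchar_mul a 0 0; rewrite addr0 => a00.
by rewrite -[LHS]mulr1 -(bohr_mul_conj a 0) {1}[in RHS]a00 mulrA -a00.
Qed.

Lemma bohrN (a : bohr R n) u : a (- u) = (a u)^*.
Proof.
rewrite -[LHS]mulr1 -(bohr_mul_conj a u) mulrA -bchar_mul addNr bohr0.
by rewrite mul1r.
Qed.

Lemma binv_mul (a : bohr R n) u v : (a (u + v))^* = (a u)^* * (a v)^*.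
Proof. by rewrite bchar_mul rmorphM. Qed.

Lemma binv_norm (a : bohr R n) u : `|(a u)^*| = 1.
Proof. by rewrite norm_conjC bchar_norm. Qed.

Definition binv (a : bohr R n) : bohr R n := Bohr (binv_mul a) (binv_norm a).

Lemma bmulK (a b : bohr R n) : bmul a (bmul (binv a) b) = b.
Proof. by apply: bohr_ext => u /=; rewrite mulrA bohr_mul_conj mul1r. Qed.

Lemma bmulKV (a b : bohr R n) : bmul (binv a) (bmul a b) = b.
Proof. by apply: bohr_ext => u /=; rewrite mulrA [_^* * _]mulrC bohr_mul_conj mul1r. Qed.

Lemma cmeasurable_bohr u : cmeasurable (ex_bohr u : BohrG R n -> R[i]).
Proof.
by split=> _ B mB; rewrite setTI; apply: sub_sigma_algebra; exists u, B; split=> //;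
  [left|right].
Qed.

(** Only generators need checking: the value at u of the translate of chi is a(u) chi(u), whose real
    and imaginary parts are real combinations of those of chi(u). *)
Lemma measurable_bmul (a : bohr R n) :
  measurable_fun setT (bmul a : BohrG R n -> BohrG R n).
Proof.
have mc u : cmeasurable (fun chi : BohrG R n => a u * ex_bohr u chi).
  by apply: cmeasurableM; [exact: cmeasurable_cst|exact: cmeasurable_bohr].
apply: (@measurability _ _ _ (BohrG R n) _ _ (@bohr_gen R n) erefl) => _ [_ [u [B [mB []]]] -> <-].
  exact: (mc u).1 measurableT B mB.
exact: (mc u).2 measurableT B mB.
Qed.

Lemma character_separates u : u != 0 -> exists a : bohr R n, a u != 1.
Proof.
move=> u0; have [i ui] : exists i, u ord0 i != 0.
  apply/existsP; apply: contraNT u0 => /existsPn uz; apply/eqP/rowP => i.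
  by rewrite mxE; apply/eqP; have := uz i; rewrite negbK.
(* The character will be x |-> [ex x t], with frequency and point exchanged. This t gives u . t =
   1/2, hence the value e^{i pi} = -1 at u. *)
pose t : 'rV[R]_n := \row_j (if j == i then (2 * u ord0 i)^-1 else 0).
have eM x y : ex (x + y) t = ex x t * ex y t.
  by rewrite /ex dotpDl mulrDr expiD.
exists (Bohr eM (fun x => norm_expi _)) => /=.
have -> : ex u t = expi pi.
  congr expi; rewrite /dotp (bigD1 i)//= big1 => [|j ji].
    by rewrite mxE eqxx; field.
  by rewrite mxE (negbTE ji) mulr0.
rewrite /expi cospi sinpi; apply/eqP => /(congr1 (@complex.Re R)) /= /eqP.
by rewrite eqNr oner_eq0.
Qed.

Variable nu : probability (BohrG R n) R.
Hypothesis haar : bohr_haar nu.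

Lemma Rintegral_bmul (a : bohr R n) (h : BohrG R n -> R) :
  nu.-integrable setT (EFin \o h) -> nu.-integrable setT (EFin \o (h \o bmul a)) ->
  Rintegral nu setT (h \o bmul a) = Rintegral nu setT h.
Proof.
move=> ih iha; rewrite /Rintegral; congr fine.
have mh : measurable_fun setT (EFin \o h) by exact: measurable_int ih.
have := @integral_pushforward _ _ _ _ _ _ (measurable_bmul a) nu setT _ mh iha measurableT.
rewrite preimage_setT => <-.
apply: eq_measure_integral => [|mb A mA _ /=]; first exact: measurable_bmul.
(* The pushforward measures preimages, whereas [bohr_haar] speaks of images: the preimage under
   translation by [a] is the image under translation by its inverse. *)
rewrite /pushforward -(haar (binv a) mA); congr (nu _).
apply/seteqP; split=> [chi /= Achi|_ [chi Achi <-] /=]; last by rewrite bmulK.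
by exists (bmul a chi) => //; exact: bmulKV.
Qed.

Lemma cint_ex_bohr u : u != 0 -> cint nu (ex_bohr u) = 0.
Proof.
move=> /character_separates[a au].
have ib : cintegrable nu (ex_bohr u).
  by apply: cintegrable_bounded; [exact: cmeasurable_bohr|move=> x; rewrite csq_bohr].
have [iar iai] : cintegrable nu (fun chi => a u * ex_bohr u chi) by exact: cintegrableZ.
have : cint nu (fun chi => a u * ex_bohr u chi) = cint nu (ex_bohr u).
  apply: complex_ext; rewrite /cint /=.
    (* By computation, [ex_bohr u] composed with [bmul a] is [a u] times [ex_bohr u]. *)
    exact: (Rintegral_bmul ib.1 iar).
  exact: (Rintegral_bmul ib.2 iai).
rewrite cintZ// => /eqP; rewrite -subr_eq0 -[X in _ - X]mul1r -mulrBl mulf_eq0.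
by rewrite subr_eq0 (negbTE au) => /eqP.
Qed.

Lemma cinner_ex_bohr u v : u != v -> cinner nu (ex_bohr u) (ex_bohr v) = 0.
Proof.
move=> uv; rewrite -[RHS](@cint_ex_bohr (u - v)) ?subr_eq0//.
rewrite /cinner; congr cint; apply/funext => chi.
by rewrite /ex_bohr bchar_mul bohrN.
Qed.

End Bohr.

(** * The implications between the three conditions *)

Section Equivalence.
Context {R : realType} {n : nat} (mu : probability (Rn R n) R).
Context (Lam : set 'rV[R]_n) (nu : probability (BohrG R n) R).
Hypothesis haar : bohr_haar nu.

Definition orthogonal_exps := forall l l' : 'rV[R]_n, Lam l -> Lam l' -> l <> l' ->
  cinner mu (ex l) (ex l') = 0.

(** [W] acts on representatives. It descends to classes: by the first two clauses the squared norm
    of [W f - W g] is that of [f - g], so representatives at distance zero have images at distance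
    zero. *)
Definition bohr_isometry (W : (Rn R n -> R[i]) -> (BohrG R n -> R[i])) :=
  [/\ (forall f, H_span mu Lam f ->
         L2 nu (W f) /\ L2norm2 nu (W f) = L2norm2 mu f),
      (forall (f g : Rn R n -> R[i]) (a b : R[i]),
         H_span mu Lam f -> H_span mu Lam g ->
         L2dist2 nu (W (fun x => a * f x + b * g x))
                    (fun chi => a * W f chi + b * W g chi) = 0%E) &
      (forall l, Lam l -> L2dist2 nu (W (ex l)) (ex_bohr l) = 0%E)].

Local Notation exn := (@ex R n : 'rV[R]_n -> Rn R n -> R[i]).

Let mex : forall l, cmeasurable (ex l : Rn R n -> R[i]) := cmeasurable_ex.
Let mbohr : forall l, cmeasurable (ex_bohr l : BohrG R n -> R[i]) := cmeasurable_bohr.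
Let ex1 (l : 'rV[R]_n) (x : Rn R n) : csq (ex l x) = 1 := csq_ex l x.
Let bohrE1 (l : 'rV[R]_n) (chi : BohrG R n) : csq (ex_bohr l chi) = 1 := csq_bohr chi l.

Lemma H_span_lincomb (f : Rn R n -> R[i]) : H_span mu Lam f <->
  L2 mu f /\ forall e : R, 0 < e -> exists2 s, comb_in Lam s &
    (L2dist2 mu f (lincomb exn s) < e%:E)%E.
Proof.
split=> -[f2 fE]; split=> // e /fE.
  by move=> [_ [[s [sL ->]] fs]]; exists s.
by move=> [s sL fs]; exists (lincomb exn s); split=> //; exists s.
Qed.

Lemma orthogonal_isometry : orthogonal_exps -> exists W, bohr_isometry W.
Proof.
move=> orth.
have gram l l' : Lam l -> Lam l' ->
    cinner mu (ex l) (ex l') = cinner nu (ex_bohr l) (ex_bohr l').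
  move=> Ll Ll'; have [->|ll'] := eqVneq l l'.
    by rewrite (cinner_diag mu ex1) (cinner_diag nu bohrE1).
  by rewrite orth//; [rewrite cinner_ex_bohr|apply/eqP].
pose rel := @paired _ _ _ _ _ mu nu _ exn (@ex_bohr R n) Lam.
have spanned f F : rel f F -> H_span mu Lam f.
  move=> [f2 _ fF]; apply/H_span_lincomb; split=> // e /fF[s sL [fs _]].
  by exists s.
(* Choice needs an image for every function; outside [H_span] the value 0 is a dummy. *)
have /choice[W WP] f : exists F, H_span mu Lam f -> rel f F.
  have [/H_span_lincomb[f2 fE]|nf] := pselect (H_span mu Lam f); last first.
    by exists (fun=> 0) => /nf.
  have [F fF] := paired_total mex mbohr ex1 bohrE1 gram f2 fE.
  by exists F.
exists W; split=> [f /WP fW|f g a b /WP fW /WP gW|l Ll].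
- by split; [case: fW|exact: (paired_norm mex mbohr ex1 bohrE1 gram fW)].
(* The chosen image of the combination and the combination of the chosen images are both paired with
   the same function, so uniqueness gives linearity. *)
- have abW := paired_comb mex mbohr a b fW gW.
  exact: (paired_unique mex mbohr ex1 bohrE1 gram (WP _ (spanned _ _ abW)) abW).
- have lE := paired_gen mu nu mex mbohr ex1 bohrE1 Ll.
  exact: (paired_unique mex mbohr ex1 bohrE1 gram (WP _ (spanned _ _ lE)) lE).
Qed.

Lemma H_span_comb2 (a b : R[i]) l l' : Lam l -> Lam l' ->
  H_span mu Lam (fun x => a * ex l x + b * ex l' x).
Proof.
move=> Ll Ll'; have -> : (fun x => a * ex l x + b * ex l' x) =
    lincomb exn [:: (a, l); (b, l')].
  by apply/funext => x; rewrite /lincomb big_cons big_seq1.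
apply/H_span_lincomb; split; first exact: L2_lincomb.
move=> e e0; exists [:: (a, l); (b, l')]; last by rewrite L2dist2_refl.
by move=> p; rewrite !inE => /orP[] /eqP ->.
Qed.

Lemma H_span_ex l : Lam l -> H_span mu Lam (ex l).
Proof.
move=> Ll; have := H_span_comb2 1 0 Ll Ll.
by under eq_fun do rewrite mul1r mul0r addr0.
Qed.

Lemma isometry_orthogonal W : bohr_isometry W -> orthogonal_exps.
Proof.
move=> [Wiso Wlin Wex] l l' Ll Ll' ll'.
have bohr2 u : L2 nu (ex_bohr u).
  have := L2_lincomb nu mbohr bohrE1 [:: (1, u)].
  by rewrite (_ : lincomb _ _ = ex_bohr u)//; apply/funext => x; rewrite /lincomb big_seq1 mul1r.
have normE (a b : R[i]) : L2norm2 mu (fun x => a * ex l x + b * ex l' x) =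
    L2norm2 nu (fun x => a * ex_bohr l x + b * ex_bohr l' x).
  have sp := H_span_comb2 a b Ll Ll'.
  have [Wl _] := Wiso _ (H_span_ex Ll); have [Wl' _] := Wiso _ (H_span_ex Ll').
  have [Wab <-] := Wiso _ sp.
  rewrite (L2norm2_eq_of_dist0 Wab (L2_linear a b Wl Wl'))//; last first.
    by apply: Wlin; exact: H_span_ex.
  apply: L2norm2_eq_of_dist0; [exact: L2_linear|exact: L2_linear|].
  by apply: L2dist2_comb0 => //; exact: Wex.
have bohr_orth : cinner nu (ex_bohr l) (ex_bohr l') = 0.
  by apply: cinner_ex_bohr => //; apply/eqP.
have cross (a b : R[i]) : complex.Re (a * b^* * cinner mu (ex l) (ex l')) = 0.
  have := normE a b.
  rewrite (L2norm2_lincomb2 mu mex ex1) (L2norm2_lincomb2 nu mbohr bohrE1).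
  by rewrite bohr_orth mulr0 => -[]; lra.
(* The coefficients (1, 1) kill the real part of the inner product, and (1, i) the imaginary part,
   since Re(-iz) = Im z. *)
apply: complex_ext.
  by have := cross 1 1; rewrite rmorph1 !mul1r.
have := cross 1 (0 +i* 1)%C.
by rewrite !complexRI /=; lra.
Qed.

(** [\esum] is a supremum over finite subsets of [Lam], so the finite form of Bessel's inequality
    suffices, even for uncountable [Lam]. *)
Lemma orthogonal_bessel : orthogonal_exps -> forall t : 'rV[R]_n,
  (\esum_(l in Lam) (csq (fourier mu (t - l)))%:E <= 1)%E.
Proof.
move=> orth t; apply: ge_ereal_sup => _ [A [finA AL] <-].
rewrite fsbig_finite// sumEFin lee_fin.
under eq_bigr do rewrite -cinner_ex.
apply: (bessel_unimodular mex ex1) => [|l l'].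
  exact: finmap.fset_uniq.
rewrite !in_fset_set// !inE => Al Al' /eqP ll'.
by apply: orth => //; exact: AL.
Qed.

Lemma fourier0 : fourier mu 0 = 1.
Proof.
by rewrite -(subrr (0 : 'rV[R]_n)) -cinner_ex (cinner_diag mu ex1).
Qed.

(* The terms [l] and [l'] of [h_Lam l] are [1] and [|<e_l, e_l'>|^2]. *)
Lemma bessel_orthogonal :
  (forall t : 'rV[R]_n, (\esum_(l in Lam) (csq (fourier mu (t - l)))%:E <= 1)%E) ->
  orthogonal_exps.
Proof.
move=> h1 l l' Ll Ll' ll'; rewrite cinner_ex; apply: csq_eq0; apply/eqP.
rewrite eq_le csq_ge0 andbT -(lerD2l 1) addr0 -lee_fin.
apply: le_trans (h1 l); apply: esum_ge; exists [set l; l'].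
  by split; [exact: finite_set2|move=> u [->|->]].
rewrite fsbigU//=; last by move=> u [-> /= ll]; case: ll'.
by rewrite !fsbig_set1 subrr fourier0 EFinD leeD2r// lee_fin /csq /= expr1n expr0n addr0.
Qed.

End Equivalence.

Unset Implicit Arguments.
Set Strict Implicit.
Set Printing Implicit Defensive.

Theorem theorem4p6 (R : realType) (n : nat) (mu : probability (Rn R n) R)
    (Lam : set 'rV[R]_n) (nu : probability (BohrG R n) R) :
  bohr_haar nu ->
  [<->
   (* (i) {e_lambda} orthogonal in L^2(mu) *)
   (forall l l' : 'rV[R]_n, Lam l -> Lam l' -> l <> l' ->
      cinner mu (ex l) (ex l') = 0);
   (* (ii) a linear isometry W : H(Lam) -> L^2(G, mu_Bohr) with W e_l = ~e_l *)
   (exists W : (Rn R n -> R[i]) -> (BohrG R n -> R[i]),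
      [/\ (forall f, H_span mu Lam f ->
             L2 nu (W f) /\ L2norm2 nu (W f) = L2norm2 mu f),
          (forall (f g : Rn R n -> R[i]) (a b : R[i]),
             H_span mu Lam f -> H_span mu Lam g ->
             L2dist2 nu (W (fun x => a * f x + b * g x))
                        (fun chi => a * W f chi + b * W g chi) = 0%E) &
          (forall l, Lam l -> L2dist2 nu (W (ex l)) (ex_bohr l) = 0%E)]);
   (* (iii) h_Lam(t) = sum_{l in Lam} |hat mu(t - l)|^2 <= 1 for all t *)
   (forall t : 'rV[R]_n,
      (\esum_(l in Lam) (csq (fourier mu (t - l)))%:E <= 1)%E)].
Proof.
move=> haar; tfae.
- exact: orthogonal_isometry.
- by move=> [W /(isometry_orthogonal haar)]; exact: orthogonal_bessel.
- exact: bessel_orthogonal.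
Qed.
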